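(* Let $(X,f)$ be a uniquely ergodic dynamical system and $\mu$ be the unique $f$-invariant measure. Then, for every $m\in\mathbb{N}$, $$\underline{c}^f_m(x,\varepsilon)=\overline{c}^f_m(x,\varepsilon)=c^f_m(\mu,\varepsilon)$$ for every $x\in X$ and every $\varepsilon>0$ which is a continuity point of the function $c^f_m(\mu,\cdot)$.
   Context: A dynamical system is a pair $(X,f)$ where $X=(X,\varrho)$ is a compact metric space and $f:X\to X$ is continuous; it is uniquely ergodic if it has exactly one $f$-invariant Borel probability measure. $\mathbb{N}=\{1,2,\dots\}$. For $m\in\mathbb{N}$ let $\varrho^f_m(y,z)=\max_{0\le i<m}\varrho(f^i(y),f^i(z))$. For $x\in X$, $m,n\in\mathbb{N}$, $\varepsilon>0$, $$C^f_m(x,n,\varepsilon)=\frac1{n^2}\,\mathrm{card}\{(i,j):0\le i,j<n,\ \varrho^f_m(f^i(x),f^j(x))\le\varepsilon\},$$ $\overline{c}^f_m(x,\varepsilon)=\limsup_{n\to\infty}C^f_m(x,n,\varepsilon)$, $\underline{c}^f_m(x,\varepsilon)=\liminf_{n\to\infty}C^f_m(x,n,\varepsilon)$. The correlation integral is $c^f_m(\mu,\varepsilon)=\mu\times\mu\{(y,z)\in X\times X:\varrho^f_m(y,z)\le\varepsilon\}$. *)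

(* Defs.v *)
From HB Require Import structures.
From mathcomp Require Import all_boot all_order all_algebra.
From mathcomp Require Import all_classical all_reals all_analysis.

Set Implicit Arguments.
Unset Strict Implicit.
Unset Printing Implicit Defensive.

Import Order.TTheory GRing.Theory Num.Theory.
Import numFieldNormedType.Exports.

Local Open Scope classical_set_scope.
Local Open Scope ring_scope.

(* Measurable types are pointed in the library, hence the join below.  It only
   excludes the empty space, which carries no probability measure. *)
#[short(type="pmetricType")]
HB.structure Definition PMetric (K : numDomainType) :=
  { M of Metric K M & isPointed M }.

Notation borel X := (g_sigma_algebraType (@open X)).

(* Invariance and uniqueness are tested on Borel sets only: a measure is a
   function on all subsets, with unconstrained values on nonmeasurable ones. *)
Definition invariant_measure (R : realType) (X : pmetricType R) (f : X -> X)
    (mu : probability (borel X) R) : Prop :=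
  forall A : set (borel X), measurable A -> mu (f @^-1` A) = mu A.

Definition uniquely_ergodic (R : realType) (X : pmetricType R) (f : X -> X) :
    Prop :=
  exists2 mu : probability (borel X) R, invariant_measure f mu &
    forall nu : probability (borel X) R, invariant_measure f nu ->
      forall A : set (borel X), measurable A -> nu A = mu A.

(* For m > 0 the default value 0 of the maximum is harmless, distances being
   nonnegative. *)
Definition bowen_dist (R : realType) (X : pmetricType R) (f : X -> X) (m : nat)
    (y z : X) : R :=
  \big[Num.max/0]_(i < m) mdist (iter i f y) (iter i f z).

Definition correlation_sum (R : realType) (X : pmetricType R) (f : X -> X)
    (m : nat) (x : X) (n : nat) (eps : R) : R :=
  #|[pred ij : 'I_n * 'I_n |
      bowen_dist f m (iter ij.1 f x) (iter ij.2 f x) <= eps]|%:R / n%:R ^+ 2.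

Definition upper_correlation (R : realType) (X : pmetricType R) (f : X -> X)
    (m : nat) (x : X) (eps : R) : \bar R :=
  limn_esup (fun n => (correlation_sum f m x n eps)%:E).

Definition lower_correlation (R : realType) (X : pmetricType R) (f : X -> X)
    (m : nat) (x : X) (eps : R) : \bar R :=
  limn_einf (fun n => (correlation_sum f m x n eps)%:E).

(* X being second countable when compact, the product sigma-algebra is the
   Borel sigma-algebra of X * X. *)
Definition correlation_integral (R : realType) (X : pmetricType R) (f : X -> X)
    (m : nat) (mu : probability (borel X) R) (eps : R) : \bar R :=
  (mu \x mu)%E [set yz : borel X * borel X | bowen_dist f m yz.1 yz.2 <= eps].

(* Main.v *)
Require Import Defs.
From mathcomp Require Import all_boot all_order all_algebra.
From mathcomp Require Import all_classical all_reals all_analysis.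
From HB Require Import structures.
From mathcomp Require Import measurable_realfun lra zify.
From mathcomp Require finmap.
Import Order.TTheory GRing.Theory Num.Theory.
Import numFieldNormedType.Exports.
Local Open Scope classical_set_scope.
Local Open Scope ring_scope.

Set Implicit Arguments.
Unset Strict Implicit.
Unset Printing Implicit Defensive.

(** Along an ultrafilter refining [\oo], the frequencies with which the orbit of
    [x] visits each subset converge to an [f]-invariant finitely additive
    probability [lam] on all subsets of [X].  Regularizing [lam] through covers
    by open sets gives an [f]-invariant Borel probability which is at most [lam]
    on open sets; by unique ergodicity it is [mu].  Hence the visit frequencies
    of every set with [mu]-null boundary converge to its measure.  Cutting [X]
    into finitely many such cells of small Bowen diameter, the union of the
    products of two cells that meet [{d <= eps}] lies between [{d <= eps}] and
    [{d <= eps + delta}], and its frequencies converge to its measure under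
    [mu \x mu]; continuity at [eps] closes the gap. *)

(** * Open sets and measurability in a metric space *)

Lemma open_sublevel {R : realType} {T : topologicalType} (g : T -> R) (r : R) :
  continuous g -> open [set z | g z < r].
Proof.
by move=> cg; apply: (@open_comp _ _ g [set r' | r' < r]) => [z _|];
  [exact: cg|exact: open_lt].
Qed.

Section metric.
Context {R : realType} {X : pmetricType R}.

Lemma continuous_mdist (w : X) : continuous (mdist w).
Proof.
move=> y; apply/cvgrPdist_lt => e e0; near=> z.
have yz : mdist y z < e.
  have : ball y e z by near: z; exact: nbhsx_ballx.
  by rewrite ballEmdist.
have := metric_triangle w y z; have := metric_triangle w z y.
rewrite (metric_sym z y) ltr_norml; lra.
Unshelve. all: by end_near. Qed.

(** The set $K_j$ consists of the points at distance at least $1/(j+1)$ from every point outside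
    $O$, written as the complement of a union of open balls so that it is visibly closed. These sets
    supply the approximation from inside in [closed_caratheodory]. *)
Lemma open_exhaustion (O : set X) : open O -> exists K : nat -> set X,
  [/\ forall j, closed (K j), forall j, K j `<=` (K j.+1)^°,
      forall j, K j `<=` O & O `<=` \bigcup_j (K j)^°].
Proof.
move=> oO; exists (fun j =>
  ~` \bigcup_(w in ~` O) [set z | mdist w z < j.+1%:R^-1]).
(* Lowering the radius from [a] to [b] leaves a margin [a - b] in the triangle inequality. This
   yields both the nesting of the [K j] and the covering of [O] by their interiors. *)
have incl (a b : R) : b < a ->
    ~` (\bigcup_(w in ~` O) [set z | mdist w z < a]) `<=`
    (~` (\bigcup_(w in ~` O) [set z | mdist w z < b]))^°.
  move=> ba y Ky; rewrite /interior; near=> z; move=> -[w Ow /= wz]; apply: Ky.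
  exists w => //=.
  have yz : mdist y z < a - b.
    have : ball y (a - b) z by near: z; apply: nbhsx_ballx; lra.
    by rewrite ballEmdist.
  by have := metric_triangle w z y; rewrite (metric_sym z y); lra.
split.
- move=> j; apply: open_closedC; apply: bigcup_open => w _.
  by apply: open_sublevel; exact: continuous_mdist.
- by move=> j; apply: incl; rewrite ltf_pV2 ?posrE// ltr_nat.
- move=> j z Kz; apply: contrapT => Oz; apply: Kz; exists z => //=.
  by rewrite mdistxx.
- move=> y Oy; have : nbhs y O by exact: open_nbhs_nbhs.
  move=> /nbhs_ballP[e /= e0]; rewrite ballEmdist => yeO.
  have [j] := @ltr_add_invr R 0 e e0; rewrite add0r => je.
  exists j => //; apply: (incl e) => // -[w Ow /= wy]; apply: Ow; apply: yeO => /=.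
  by rewrite metric_sym.
Unshelve. all: by end_near. Qed.

End metric.

Lemma measurable_continuous {R : realType} {X : pmetricType R} (f : X -> X) :
  continuous f -> measurable_fun [set: borel X] (f : borel X -> borel X).
Proof.
move=> /continuousP cf.
apply: (measurability (@open X : set (set (borel X)))) => // _ [G oG <-].
by rewrite setTI; apply: sub_sigma_algebra; exact: cf.
Qed.

Lemma measurable_continuous_real {R : realType} {X : pmetricType R}
    (g : X -> R) :
  continuous g -> measurable_fun [set: borel X] (g : borel X -> R).
Proof.
move=> /continuousP cg.
apply: (measurability _ (RGenOpens.measurableE R)) => _ [_ [a [b ->]] <-].
by rewrite setTI; apply: sub_sigma_algebra; apply: cg; exact: interval_open.
Qed.

(** * From a finitely additive probability to a Borel probability *)

Section regularization.
Context {R : realType} {X : pmetricType R} (lam : set X -> R).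
Hypothesis lam_ge0 : forall A, 0 <= lam A.
Hypothesis lamU :
  forall A B, A `&` B = set0 -> lam (A `|` B) = lam A + lam B.

Lemma fadd0 : lam set0 = 0.
Proof. by have := lamU (setI0 set0); rewrite setU0; lra. Qed.

Lemma faddD A B : B `<=` A -> lam (A `\` B) = lam A - lam B.
Proof.
move=> BA; have : lam (B `|` (A `\` B)) = lam B + lam (A `\` B).
  by apply: lamU; apply/seteqP; split=> z // [? []].
by rewrite setDUK// => ->; rewrite addrAC subrr add0r.
Qed.

Lemma le_fadd A B : A `<=` B -> lam A <= lam B.
Proof. by move=> AB; have := lam_ge0 (B `\` A); rewrite faddD// subr_ge0. Qed.

Lemma fadd_bigsetU (F : nat -> set X) n :
  lam (\big[setU/set0]_(i < n) F i) <= \sum_(i < n) lam (F i).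
Proof.
elim: n => [|n ih]; first by rewrite !big_ord0 fadd0.
rewrite !big_ord_recr/=; set B := \big[setU/set0]_(i < n) _ in ih *.
have -> : B `|` F n = B `|` (F n `\` B).
  apply/seteqP; split=> z; last by case=> [|[]]; [left|right].
  by case=> [|Fz]; [left|have [|] := pselect (B z); [left|right]].
rewrite lamU; last by apply/seteqP; split=> z // [? []].
by apply: lerD => //; apply: le_fadd => z [].
Qed.

(* [mu_ext] takes covers by Borel sets; the value [+oo] leaves only the open
   covers. *)
Definition open_weight (A : set (borel X)) : \bar R :=
  if `[< open (A : set X) >] then (lam A)%:E else +oo%E.

Lemma open_weightE (G : set X) : open G -> open_weight G = (lam G)%:E.
Proof. by move=> oG; rewrite /open_weight asboolT. Qed.

Lemma open_weight_ge0 (A : set (borel X)) : (0 <= open_weight A)%E.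
Proof. by rewrite /open_weight; case: ifP => // _; rewrite lee_fin. Qed.

Lemma open_weight0 : open_weight set0 = 0%E.
Proof. by rewrite open_weightE ?fadd0//; exact: open0. Qed.

Definition outer_reg : set X -> \bar R := mu_ext open_weight.

Lemma outer_reg_le (A : set X) (F : nat -> set X) :
  (forall k, open (F k)) -> A `<=` \bigcup_k F k ->
  (outer_reg A <= \sum_(k <oo) (lam (F k))%:E)%E.
Proof.
move=> oF AF; apply: ereal_inf_lbound; exists F.
  by split=> // k; exact: sub_sigma_algebra.
by apply: eq_eseriesr => k _; rewrite open_weightE.
Qed.

(** A cover with a nonopen member has total weight $+\infty$, so the bound needs testing on open
    covers alone. *)
Lemma outer_reg_ge (A : set X) (y : \bar R) :
  (forall F : nat -> set X, (forall k, open (F k)) -> A `<=` \bigcup_k F k ->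
    (y <= \sum_(k <oo) (lam (F k))%:E)%E) ->
  (y <= outer_reg A)%E.
Proof.
move=> yF; apply: le_ereal_inf_tmp => _ [F [_ AF] <-].
have [oF|/existsNP[k nF]] := pselect (forall k, open (F k : set X)).
  under eq_eseriesr do rewrite open_weightE//.
  exact: yF.
rewrite (@eseries_pinfty _ _ xpredT k) ?leey//.
  by move=> n _; rewrite gt_eqF// (lt_le_trans _ (open_weight_ge0 _)).
by rewrite /open_weight asboolF.
Qed.

Lemma outer_reg_open (G : set X) : open G -> (outer_reg G <= (lam G)%:E)%E.
Proof.
move=> oG; apply: le_trans (@outer_reg_le G (bigcup2 G set0) _ _) _.
- by case=> [|[|k]]//=; exact: open0.
- by move=> z Gz; exists 0%N.
rewrite (nneseries_split 0 1)//; last by move=> *; rewrite lee_fin.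
rewrite add0n big_nat1/= eseries0 ?adde0// => -[|[|k]]//= _ _; by rewrite fadd0.
Qed.

Fact outer_reg_ge0 (A : set X) : (0 <= outer_reg A)%E.
Proof. by apply: mu_ext_ge0; [exact: open_weight_ge0]. Qed.

Fact outer_reg0 : outer_reg set0 = 0%E.
Proof. by apply: mu_ext0; [exact: open_weight0|exact: open_weight_ge0]. Qed.

Fact outer_reg_sigma_subadditive : sigma_subadditive outer_reg.
Proof. exact: (mu_ext_sigma_subadditive open_weight_ge0). Qed.

HB.instance Definition _ := isOuterMeasure.Build R X outer_reg
  outer_reg0 outer_reg_ge0 (@le_mu_ext _ _ _ open_weight)
  outer_reg_sigma_subadditive.

(* The open shells [K (j + 2)° \ K j] together with [K (N + 1)°] cover [O], and
   their weights telescope. *)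
Lemma outer_reg_exhaustion (O : set X) (K : nat -> set X) (s : R) (N : nat) :
  (forall j, closed (K j)) -> (forall j, K j `<=` (K j.+1)^°) ->
  O `<=` \bigcup_j (K j)^° -> (forall j, lam (K j) <= s) ->
  (outer_reg O <= (s + s - lam (K N))%:E)%E.
Proof.
move=> cK KK OK Ks.
have homoK i j : (i <= j)%N -> K i `<=` K j.
  elim: j => [|j ih]; first by rewrite leqn0 => /eqP ->.
  rewrite leq_eqVlt => /orP[/eqP->//|]; rewrite ltnS => /ih Kij.
  by apply: subset_trans Kij (subset_trans (KK j) _); exact: interior_subset.
pose F k := if k is k'.+1 then (K (N + k').+2)^° `\` K (N + k')%N
            else (K N.+1)^°.
apply: le_trans (@outer_reg_le O F _ _) _.
- case=> [|k] /=; first exact: open_interior.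
  by rewrite setDE; apply: openI; [exact: open_interior|exact: closed_openC].
- move=> z Oz.
  (* Take the least index whose interior contains [z]. If it exceeds [N.+1], minimality and [KK]
     keep [z] out of the [K] two steps earlier, which places [z] in a shell. *)
  have [[|j] Kz minz] : exists2 j, (K j)^° z &
      forall i, (i < j)%N -> ~ (K i)^° z.
    have [j _ Kz] := OK _ Oz.
    have ex : exists j, `[< (K j)^° z >] by exists j; exact/asboolP.
    exists (ex_minn ex); case: ex_minnP => i /asboolP// _ mi k ki /asboolP/mi.
    by rewrite leqNgt ki.
  - exists 0%N => //=; exact: (interiorS (homoK _ _ (leq0n _))).
  have [jN|Nj] := leqP j.+1 N.+1.
    by exists 0%N => //=; exact: (interiorS (homoK _ _ jN)).
  case: j Nj Kz minz => // j Nj Kz minz; rewrite ltnS ltnS in Nj.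
  exists (j - N).+1 => //=; rewrite subnKC//; split=> //.
  by move=> /KK; exact: minz.
apply: lime_le; first by apply: is_cvg_nneseries => *; rewrite lee_fin.
apply: nearW => -[|n]; rewrite sumEFin lee_fin.
  by rewrite big_geq//; have := Ks N; have := lam_ge0 (K N); lra.
(* Each shell spans two consecutive indices, so the telescoped sum keeps two end terms, each at most
   [s]. *)
apply: (@le_trans _ _ (lam (K (N + n)%N) + lam (K (N + n).+1) - lam (K N)));
  last first.
  by rewrite lerD2r lerD.
elim: n => [|n ih].
  rewrite big_nat1 /= addn0 addrAC subrr add0r; apply: le_fadd.
  exact: interior_subset.
rewrite big_nat_recr//=.
have : lam ((K (N + n).+2)^° `\` K (N + n)%N) <=
    lam (K (N + n).+2) - lam (K (N + n)%N).
  rewrite -faddD; last by apply: homoK; lia.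
  by apply: le_fadd; apply: setSD; exact: interior_subset.
rewrite addnS; move: ih; lra.
Qed.

(** It suffices to split one open $G$ of a cover. Exhaust $G\setminus F$ by closed $K_j$ and let
    $s=\sup_j\lambda(K_j)$, which may lie below $\lambda(G\setminus F)$ as $\lambda$ is only
    finitely additive. The open set $G\setminus K_N$ contains $G\cap F$ and weighs
    $\lambda(G)-\lambda(K_N)$, while $G\setminus F$ has outer measure at most $2s-\lambda(K_N)$. The
    sum exceeds $\lambda(G)$ by at most $2(s-\lambda(K_N))$, whence the choice of $N$ with
    $s-\lambda(K_N)<e/2$. *)
Lemma closed_caratheodory (F : set X) : closed F -> outer_reg.-caratheodory F.
Proof.
move=> cF; apply: le_caratheodory_measurable => A.
apply: outer_reg_ge => G oG AG.
apply: (@le_trans _ _ (\sum_(k <oo)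
    (outer_reg (G k `&` F) + outer_reg (G k `&` ~` F)))%E).
  rewrite nneseriesD; [|by move=> *; exact: outer_measure_ge0..].
  apply: leeD.
  - apply: (le_trans _ (outer_measure_sigma_subadditive _ (fun k => G k `&` F))).
    by apply: le_outer_measure; rewrite -setI_bigcupl; exact: setSI.
  - apply: (le_trans _ (outer_measure_sigma_subadditive _ (fun k => G k `&` ~` F))).
    by apply: le_outer_measure; rewrite -setI_bigcupl; exact: setSI.
apply: lee_nneseries => k _.
  by move=> _; apply: adde_ge0; exact: outer_measure_ge0.
have oO : open (G k `&` ~` F) by apply: openI => //; exact: closed_openC.
have [K [cK KK KO OK]] := open_exhaustion oO.
have hs : has_sup (range (lam \o K)).
  split; first by exists (lam (K 0%N)), 0%N.
  by exists (lam (G k)) => _ [j _ <-]; apply: le_fadd => z /KO[].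
apply/lee_addgt0Pr => e e0.
have e20 : 0 < e / 2 by rewrite divr_gt0.
have [_ [N _ <-] /= sN] := sup_adherent e20 hs.
have Ks j : lam (K j) <= sup (range (lam \o K)).
  by apply: ub_le_sup; [case: hs|exists j].
have := outer_reg_exhaustion N cK KK OK Ks.
have : (outer_reg (G k `&` F) <= (lam (G k) - lam (K N))%:E)%E.
  rewrite -faddD; last by move=> z /KO[].
  apply: (@le_trans _ _ (outer_reg (G k `\` K N))).
    apply: le_outer_measure => z [Gz Fz]; split => // /KO[_]; exact.
  apply: outer_reg_open; rewrite setDE; apply: openI => //; exact: closed_openC.
move=> /leeD h /h /le_trans; apply.
rewrite -EFinD lee_fin; lra.
Qed.

Hypothesis cX : compact [set: X].
Hypothesis lamT : lam [set: X] = 1.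

(** Compactness reduces a countable open cover to a finite one, where finite subadditivity of [lam]
    gives the lower bound 1. *)
Lemma outer_regT : outer_reg [set: X] = 1%E.
Proof.
apply/eqP; rewrite eq_le; apply/andP; split.
  by rewrite -lamT; apply: outer_reg_open => //; exact: openT.
apply: outer_reg_ge => // F oF TF.
move: cX; rewrite compact_cover.
move=> /(_ nat setT F (fun i _ => oF i) TF) [D _ TD].
(* One more than the largest index of the subcover, so that the first [n] sets of [F] cover [X]. *)
pose n := (\max_(i <- finmap.enum_fset D) i).+1.
apply: le_trans (nneseries_lim_ge n _); last by move=> *; rewrite lee_fin.
rewrite sumEFin lee_fin -lamT big_mkord; apply: le_trans (fadd_bigsetU F n).
apply: le_fadd => // z _; have [i /= iD Fz] := TD z I.
rewrite -bigcup_mkord; exists i => //=; rewrite /n ltnS.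
exact: leq_bigmax_seq.
Qed.

Lemma borel_caratheodory (A : set (borel X)) :
  measurable A -> outer_reg.-caratheodory A.
Proof.
have := sigma_algebra_measurable (caratheodory_type outer_reg).
move=> /smallest_sub; apply => G oG.
by rewrite -[G]setCK; apply: caratheodory_measurable_setC;
  apply: closed_caratheodory; exact: open_closedC.
Qed.

(** The function [outer_reg] retyped on [borel X], to carry the measure structure there. *)
Definition regularization : set (borel X) -> \bar R := outer_reg.

Fact regularization_sigma_additive : semi_sigma_additive regularization.
Proof.
move=> F mF tF mUF.
apply: (@caratheodory_measure_sigma_additive _ _ outer_reg) => //.
- by move=> i; exact: borel_caratheodory.
- exact: borel_caratheodory.
Qed.

HB.instance Definition _ := isMeasure.Build _ _ _ regularization
  outer_reg0 outer_reg_ge0 regularization_sigma_additive.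

HB.instance Definition _ :=
  Measure_isProbability.Build _ _ _ regularization outer_regT.

Lemma regularization_open (G : set X) :
  open G -> (regularization G <= (lam G)%:E)%E.
Proof. exact: outer_reg_open. Qed.

(** Pulling an open cover of $A$ back along $f$ gives an open cover of $f^{-1}(A)$ with the same
    weights, hence one inequality. Applied to the complement of $A$, it gives the other, the total
    mass being 1. *)
Lemma regularization_invariant (f : X -> X) :
  continuous f -> (forall A, lam (f @^-1` A) = lam A) ->
  invariant_measure f regularization.
Proof.
move=> cf flam; pose nu : probability _ R := regularization.
have mf (A : set (borel X)) :
    measurable A -> measurable (f @^-1` A : set (borel X)).
  by move=> mA; rewrite -[X in measurable X]setTI; exact: measurable_continuous.
have le (A : set (borel X)) : measurable A -> (nu (f @^-1` A) <= nu A)%E.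
  move=> mA; apply: outer_reg_ge => F oF AF.
  under eq_eseriesr do rewrite -flam.
  apply: outer_reg_le; first by move=> k; move/continuousP : cf; exact.
  by move=> z /AF[k _ Fz]; exists k.
move=> A mA; apply/eqP; rewrite eq_le (le A mA)/=.
rewrite -[leLHS]/(nu A) -[leRHS]/(nu (f @^-1` A)).
have := le (~` A) (measurableC mA).
rewrite preimage_setC.
rewrite (probability_setC nu mA) (probability_setC nu (mf A mA)).
have : nu (f @^-1` A) \is a fin_num by apply: fin_num_measure; exact: mf.
have : nu A \is a fin_num by exact: fin_num_measure.
move=> /fineK <- /fineK <-; rewrite -!EFinB !lee_fin; lra.
Qed.

End regularization.

(** * Convergence along ultrafilters *)

Lemma ultra_fmap {T S : Type} (U : set_system T) (g : T -> S) :
  UltraFilter U -> UltraFilter (g @ U).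
Proof.
move=> FU; split; first exact: fmap_proper_filter.
move=> G GF UG; apply/seteqP; split=> // A GA.
have [//|UA] := in_ultra_setVsetC (g @^-1` A) FU.
have GNA : G (~` A) by apply: UG.
by have /filter_ex[z [Az /(_ Az)]] : G (A `&` ~` A) by exact: filterI.
Qed.

(** If a neighbourhood $A$ of $l$ failed, the trace of $F$ on $g^{-1}(X\setminus A)$, with $X$ the
    target space, would be a proper filter. An ultrafilter refining it would then contain two
    disjoint sets. *)
Lemma cvg_ultra {T : Type} {Y : topologicalType} (F : set_system T)
    (g : T -> Y) (l : Y) : Filter F ->
  (forall U, UltraFilter U -> F `<=` U -> g @ U --> l) -> g @ F --> l.
Proof.
move=> FF h A lA; apply: contrapT => FA.
pose B := g @^-1` (~` A).
have PF : ProperFilter (within B F).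
  apply: Build_ProperFilter; rewrite /within/= => FD; apply: FA.
  by apply: filterS FD => z BD; apply: contrapT => /BD.
have [U [UU BU]] := ultraFilterLemma PF.
have UA : U (g @^-1` A).
  by apply: (h U UU) => // D FD; apply: BU; apply: filterS FD.
have UB : U B by apply: BU; exact: withinT.
have UP : ProperFilter U by exact: ultra_proper.
by have /filter_ex[z [Az /(_ Az)]] : U (g @^-1` A `&` B) by exact: filterI.
Qed.

(** * Visit frequencies of an orbit and their ultralimits *)

Section frequency.
Context {R : realType} {X : Type} (f : X -> X) (x : X).

Definition freq (A : set X) (n : nat) : R :=
  (\sum_(i < n) \1_A (iter i f x)) / n%:R.

Lemma freq_ge0 A n : 0 <= freq A n.
Proof. by rewrite divr_ge0// sumr_ge0// => i _; rewrite indicE ler0n. Qed.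

Lemma freq_le1 A n : freq A n <= 1.
Proof.
case: n => [|n]; first by rewrite /freq big_ord0 mul0r.
rewrite ler_pdivrMr ?ltr0Sn// mul1r.
apply: (@le_trans _ _ (\sum_(i < n.+1) 1)); last by rewrite sumr_const card_ord.
by apply: ler_sum => i _; rewrite indicE lern1 leq_b1.
Qed.

Lemma freqU A B : A `&` B = set0 -> freq (A `|` B) = freq A \+ freq B.
Proof.
move=> AB; apply/funext => n; rewrite /freq/= -mulrDl -big_split/=.
congr (_ / _); apply: eq_bigr => i _; rewrite !indicE in_setU.
have [iA|iA] := pselect (A (iter i f x)); last by rewrite (memNset iA) add0r.
rewrite (mem_set iA) memNset ?addr0// => iB.
by have : (A `&` B) (iter i f x) by []; rewrite AB.
Qed.

Lemma freqT n : freq [set: X] n.+1 = 1.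
Proof.
rewrite /freq indicT/= sumr_const card_ord divff//.
Qed.

(** The two sums telescope to $1_A(f^n(x))-1_A(x)$, of absolute value at most 1. *)
Lemma freq_preimage A n : `|freq (f @^-1` A) n - freq A n| <= n%:R^-1.
Proof.
rewrite /freq -mulrBl normrM normfV (ger0_norm (ler0n _ n)).
rewrite -[leRHS]mul1r ler_wpM2r ?invr_ge0//.
have -> : \sum_(i < n) \1_(f @^-1` A) (iter i f x) =
          \sum_(i < n) \1_A (iter i.+1 f x) :> R.
  by apply: eq_bigr => i _; rewrite !indicE; congr (_%:R).
rewrite -sumrB.
rewrite -(big_mkord xpredT (fun i => \1_A (iter i.+1 f x) - \1_A (iter i f x))).
rewrite (telescope_sumr (fun i => \1_A (iter i f x)))// !indicE.
by case: (_ \in _); case: (_ \in _); rewrite /= ?subrr ?normr0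
  ?subr0 ?sub0r ?normrN ?normr1.
Qed.

Section ultralimit.
Context (U : set_system nat) (UU : UltraFilter U) (ooU : \oo `<=` U).

Definition ulim_freq (A : set X) : R := lim (freq A @ U).

(** Frequencies lie in the compact interval $[0,1]$, where every ultrafilter converges. *)
Lemma cvg_ulim_freq A : freq A @ U --> ulim_freq A.
Proof.
have := @segment_compact R 0 1; rewrite compact_ultra.
move=> /(_ (freq A @ U) (ultra_fmap _ _)) [].
  suff : U [set n | freq A n \in `[0, 1]] by [].
  by apply: filterE => n; rewrite /= in_itv/= freq_ge0 freq_le1.
by move=> l [_ fl]; apply: (cvgP l).
Qed.

Lemma ulim_freqE A (l : R) : freq A @ U --> l -> ulim_freq A = l.
Proof. by move=> /cvg_lim; apply. Qed.

Lemma ulim_freq_ge0 A : 0 <= ulim_freq A.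
Proof.
apply: (limr_ge (cvgP _ (@cvg_ulim_freq A))).
by apply: filterE => n; exact: freq_ge0.
Qed.

Lemma ulim_freqU A B : A `&` B = set0 ->
  ulim_freq (A `|` B) = ulim_freq A + ulim_freq B.
Proof.
move=> AB; apply: ulim_freqE; rewrite freqU//.
by apply: cvgD; exact: cvg_ulim_freq.
Qed.

Lemma ulim_freqT : ulim_freq [set: X] = 1.
Proof.
apply: ulim_freqE; apply: cvg_near_cst; apply: ooU.
by exists 1%N => // -[]// n _ /=; exact: freqT.
Qed.

Lemma ulim_freq_preimage A : ulim_freq (f @^-1` A) = ulim_freq A.
Proof.
apply: ulim_freqE.
have -> : freq (f @^-1` A) = freq A \+ (freq (f @^-1` A) \- freq A).
  by apply/funext => n /=; rewrite addrC subrK.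
rewrite -[X in _ --> X]addr0; apply: cvgD; first exact: cvg_ulim_freq.
apply: cvg_trans (_ : (freq (f @^-1` A) \- freq A) @ \oo --> 0).
  by move=> D; exact: ooU.
(* After the shift, the bound of [freq_preimage] is the harmonic sequence. *)
rewrite -cvg_shiftS; apply/norm_cvg0P.
apply: (squeeze_cvgr _ (cvg_cst 0) cvg_harmonic).
by apply: nearW => n; rewrite normr_ge0 freq_preimage.
Qed.

End ultralimit.
End frequency.

(** * Convergence of visit frequencies under unique ergodicity *)

Section unique_ergodicity.
Context {R : realType} {X : pmetricType R} (f : X -> X).
Hypotheses (cX : compact [set: X]) (cf : continuous f).
Hypothesis uf : uniquely_ergodic f.
Context (mu : probability (borel X) R).
Hypothesis fmu : invariant_measure f mu.

Lemma ulim_freq_open (x : X) (U : set_system nat) (G : set (borel X)) :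
  UltraFilter U -> \oo `<=` U -> open (G : set X) ->
  (mu G <= (ulim_freq f x U G)%:E)%E.
Proof.
move=> UU ooU oG.
have nuf := regularization_invariant (ulim_freq_ge0 _ _ UU)
  (ulim_freqU _ _ UU) cX (ulim_freqT _ _ UU ooU) cf (ulim_freq_preimage f x UU ooU).
have [mu0 _ uniq] := uf.
have mG : measurable G by exact: sub_sigma_algebra.
(* Both [mu] and the regularization agree on [G] with the measure [mu0] provided by unique
   ergodicity. *)
rewrite (uniq _ fmu _ mG) -(uniq _ nuf _ mG).
exact: (regularization_open (ulim_freq_ge0 f x UU) (ulim_freqU f x UU) oG).
Qed.

(* Equivalently, the boundary of [A] is [mu]-null. *)
Definition squeezed (A : set (borel X)) := measurable A /\
  exists G K : set (borel X),
  [/\ open (G : set X), closed (K : set X), G `<=` A, A `<=` K &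
      mu (K `\` G) = 0%E].

Lemma measurable_closed (K : set (borel X)) : closed (K : set X) -> measurable K.
Proof.
move=> cK; rewrite -[K]setCK; apply: measurableC; apply: sub_sigma_algebra.
exact: closed_openC.
Qed.

(** For each ultralimit $\lambda$ of the frequencies,
    $\mu(G)\le\lambda(G)\le\lambda(A)\le\lambda(K)\le\mu(K)$, the last inequality being the bound
    for the open complement of $K$. The two ends both equal $\mu(A)$. *)
Lemma cvg_freq (x : X) (A : set (borel X)) :
  squeezed A -> freq f x A @ \oo --> fine (mu A).
Proof.
move=> [mA [G [K [oG cK GA AK GK]]]].
have mG : measurable G by exact: sub_sigma_algebra.
have mK := measurable_closed cK.
have fA : mu A \is a fin_num by exact: fin_num_measure.
have GKE : mu K = mu G.
  rewrite -[in LHS](setDUK (subset_trans GA AK)) measureU; last 3 first.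
  - exact: mG.
  - exact: (measurableD mK mG).
  - by apply/seteqP; split=> z // [? []].
  by rewrite -[RHS]adde0 -GK.
have AG : mu A = mu G.
  apply/eqP; rewrite eq_le; apply/andP; split; last by apply: le_measure; rewrite ?inE.
  by rewrite -GKE; apply: le_measure; rewrite ?inE.
have AKE : mu A = mu K by rewrite AG GKE.
apply: (@cvg_ultra _ _ \oo) => U UU ooU.
suff <- : ulim_freq f x U A = fine (mu A) by exact: cvg_ulim_freq.
have le (B C : set X) : B `<=` C -> ulim_freq f x U B <= ulim_freq f x U C :> R.
  exact: (le_fadd (ulim_freq_ge0 f x UU) (ulim_freqU f x UU)).
apply/eqP; rewrite eq_le; apply/andP; split; last first.
  by rewrite -lee_fin fineK// AG (le_trans (ulim_freq_open x UU ooU oG))// lee_fin le.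
rewrite (le_trans (le _ _ AK))// -lee_fin fineK// AKE.
have := ulim_freq_open x UU ooU (closed_openC cK).
have : ulim_freq f x U (K `|` ~` K) = ulim_freq f x U K + ulim_freq f x U (~` K) :> R.
  by apply: ulim_freqU; rewrite setICr.
rewrite setUCr (ulim_freqT f x UU ooU) (probability_setC mu mK) => h.
rewrite -AKE -(fineK fA) -EFinB !lee_fin; lra.
Qed.

End unique_ergodicity.

(** * The Bowen distance as a continuous pseudometric *)

Section bowen.
Context {R : realType} {X : pmetricType R} (f : X -> X) (m : nat).
Local Notation d := (bowen_dist f m).

Lemma bowen_dist_ge0 y z : 0 <= d y z.
Proof. exact: bigmax_ge_id. Qed.

Lemma bowen_distxx y : d y y = 0.
Proof.
apply/eqP; rewrite eq_le bowen_dist_ge0 andbT.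
by apply: bigmax_le => // i _; rewrite mdistxx.
Qed.

Lemma bowen_dist_sym y z : d y z = d z y.
Proof. by apply: eq_bigr => i _; rewrite metric_sym. Qed.

Lemma bowen_dist_triangle y z w : d y w <= d y z + d z w.
Proof.
apply: bigmax_le => [|i _]; first by rewrite addr_ge0// bowen_dist_ge0.
apply: le_trans (metric_triangle _ (iter i f z) _) _.
apply: lerD; apply: (le_bigmax_seq _ i) => //.
Qed.

Lemma continuous_bowen_dist y : continuous f -> continuous (d y).
Proof.
(* The point [y] is generalized because the recursion
   $\varrho_{k+1}(y,w)=\max(\varrho(y,w),\varrho_k(f(y),f(w)))$ passes to $f(y)$. *)
move=> cf; elim: m y => [|k ih] y z.
  rewrite (_ : bowen_dist f 0 y = cst 0); first exact: cvg_cst.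
  by apply/funext => w; rewrite /bowen_dist big_ord0.
have -> : bowen_dist f k.+1 y = mdist y \max (bowen_dist f k (f y) \o f).
  apply/funext => w; rewrite /bowen_dist big_ord_recl/=; congr (Num.max _ _).
  by apply: eq_bigr => i _; rewrite -!iterSr.
apply: continuous_max; first exact: continuous_mdist.
by apply: continuous_comp; [exact: cf|exact: ih].
Qed.

End bowen.

(** * Sets with null boundary and partitions into small cells *)

Section squeezed_sets.
Context {R : realType} {X : pmetricType R} (mu : probability (borel X) R).

Lemma squeezed0 : squeezed mu set0.
Proof.
split=> //; exists set0, set0; split => //; [exact: open0|exact: closed0|].
by rewrite setD0 measure0.
Qed.

Lemma squeezedC A : squeezed mu A -> squeezed mu (~` A).
Proof.
move=> [mA [G [K [oG cK GA AK GK]]]]; split; first exact: measurableC.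
exists (~` K), (~` G); split.
- exact: closed_openC.
- exact: open_closedC.
- exact: subsetC.
- exact: subsetC.
- by rewrite setDE setCK setIC -setDE.
Qed.

Lemma squeezedU A B : squeezed mu A -> squeezed mu B -> squeezed mu (A `|` B).
Proof.
move=> [mA [G [K [oG cK GA AK GK]]]] [mB [G' [K' [oG' cK' GB BK GK']]]].
split; first exact: measurableU.
exists (G `|` G'), (K `|` K'); split.
- exact: openU.
- exact: closedU.
- exact: setUSS.
- exact: setUSS.
have mG : measurable G by exact: sub_sigma_algebra.
have mG' : measurable G' by exact: sub_sigma_algebra.
have mK := measurable_closed cK.
have mK' := measurable_closed cK'.
have mKG : measurable (K `\` G) by exact: measurableD.
have mKG' : measurable (K' `\` G') by exact: measurableD.
apply: (subset_measure0 (B := (K `\` G) `|` (K' `\` G'))).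
- by apply: measurableD; exact: measurableU.
- exact: measurableU.
- by move=> z [[Kz|Kz] /not_orP[? ?]]; [left|right].
- by apply: null_set_setU.
Qed.

Lemma squeezedD A B : squeezed mu A -> squeezed mu B -> squeezed mu (A `\` B).
Proof.
move=> sA sB; rewrite setDE -[A]setCK -setCU; apply: squeezedC.
by apply: squeezedU => //; exact: squeezedC.
Qed.

Lemma squeezed_seqDU (F : nat -> set (borel X)) n :
  (forall i, squeezed mu (F i)) -> squeezed mu (seqDU F n).
Proof.
move=> sF; apply: squeezedD => //; elim/big_ind : _ => //.
- exact: squeezed0.
- by move=> A B; exact: squeezedU.
Qed.

(** The law of $g$ under $\mu$ has at most countably many atoms, whereas $(a,b)$ has positive
    Lebesgue measure. *)
Lemma null_level (g : X -> R) (a b : R) : continuous g -> a < b ->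
  exists2 r, a < r < b & mu (g @^-1` [set r]) = 0%E.
Proof.
move=> cg ab; apply: contrapT => nr.
pose h : {RV mu >-> R} := mfun_Sub (mem_set (measurable_continuous_real cg)).
have abs : `]a, b[ `<=` [set r | 0 < pmf h r].
  move=> r /=; rewrite in_itv/= => rab.
  rewrite /pmf lt_neqAle fine_ge0 ?andbT//; apply/eqP => h0.
  apply: nr; exists r => //.
  have : mu (g @^-1` [set r]) \is a fin_num.
    apply: fin_num_measure; exact: (measurable_funPTI h).
  by move=> /fineK <-; rewrite [X in X%:E](_ : _ = 0).
have := countable_lebesgue_measure0
  (sub_countable (subset_card_le abs) (pmf_gt0_countable h)).
rewrite lebesgue_measure_itv/= lte_fin ab -EFinB => -[]; lra.
Qed.

Lemma squeezed_sublevel (g : X -> R) (r : R) : continuous g ->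
  mu (g @^-1` [set r]) = 0%E -> squeezed mu [set z | g z < r].
Proof.
move=> cg g0; have og := open_sublevel r cg.
split; first exact: sub_sigma_algebra.
exists [set z | g z < r], [set z | g z <= r]; split => //.
- by apply: (@closed_comp _ _ g [set r' | r' <= r]) => [z _|];
    [exact: cg|exact: closed_le].
- by move=> z /=; exact: ltW.
rewrite -[RHS]g0; congr (mu _); apply/seteqP; split=> z /=.
  by move=> [zr /negP]; rewrite -leNgt => rz; apply/eqP; rewrite eq_le zr rz.
by move=> ->; rewrite lexx ltxx.
Qed.

(** Balls of [d] whose spheres are null cover $X$. The cells are the successive differences of a
    finite subcover, and differences preserve [squeezed]. *)
Lemma squeezed_cells (d : X -> X -> R) (delta : R) : compact [set: X] ->
  (forall y, d y y = 0) -> (forall y z, d y z = d z y) ->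
  (forall y z w, d y w <= d y z + d z w) -> (forall y, continuous (d y)) ->
  0 < delta -> exists k (A : nat -> set (borel X)),
  [/\ trivIset setT A, forall i, squeezed mu (A i),
      [set: X] `<=` \bigcup_(i < k) A i &
      forall i y z, A i y -> A i z -> d y z < delta].
Proof.
move=> cX dxx dC dD cd delta0.
(* Radii below [delta / 2] bound the distances within a ball by [delta]; the lower bound keeps them
   positive, so that each ball contains its centre. *)
have lt2 : delta / 4 < delta / 2 by lra.
have /choice[r rP] : forall y, exists r, delta / 4 < r < delta / 2 /\
    mu (d y @^-1` [set r]) = 0%E.
  by move=> y; have [r ? ?] := null_level (cd y) lt2; exists r.
pose B y : set X := [set z | d y z < r y].
have sB y : squeezed mu (B y) by apply: squeezed_sublevel => //; exact: (rP y).2.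
have oB y : open (B y) by exact: open_sublevel.
move: cX; rewrite compact_cover => /(_ X setT B (fun i _ => oB i)) [|D _ TD].
  by move=> z _; exists z => //; rewrite /B/= dxx; have /andP[] := (rP z).1; lra.
pose s := finmap.enum_fset D; pose F i : set (borel X) := B (nth point s i).
exists (size s), (seqDU F); split.
- exact: trivIset_seqDU.
- by move=> i; apply: squeezed_seqDU => j; exact: sB.
- have -> : \bigcup_(i < size s) seqDU F i = \bigcup_(i < size s) F i.
    by rewrite !bigcup_mkord -bigsetU_seqDU.
  move=> z _; have [y /= yD Bz] := TD z I.
  exists (index y s) => /=; first by rewrite index_mem.
  by rewrite /F nth_index.
- move=> i y z Ay Az; set w := nth point s i.
  have yw : d w y < r w := subset_seqDU Ay.
  have zw : d w z < r w := subset_seqDU Az.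
  have := dD y w z; rewrite (dC y w).
  by have /andP[] := (rP w).1; lra.
Qed.

End squeezed_sets.

(** * Frequencies of pairs of orbit points *)

Section pair_frequency.
Context {R : realType} {X : Type} (f : X -> X) (x : X).

Definition pair_freq (E : set (X * X)) (n : nat) : R :=
  (\sum_(p : 'I_n * 'I_n) \1_E (iter p.1 f x, iter p.2 f x)) / n%:R ^+ 2.

Lemma le_pair_freq E F n : E `<=` F -> pair_freq E n <= pair_freq F n.
Proof.
move=> EF; rewrite ler_wpM2r ?invr_ge0 ?exprn_ge0//.
apply: ler_sum => p _; rewrite !indicE ler_nat.
by case: (boolP (_ \in E)) => // /set_mem /EF /mem_set ->.
Qed.

Lemma pair_freq0 n : pair_freq set0 n = 0.
Proof. by rewrite /pair_freq big1 ?mul0r// => p _; rewrite indic0. Qed.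

Lemma pair_freqU E F : E `&` F = set0 ->
  pair_freq (E `|` F) = pair_freq E \+ pair_freq F.
Proof.
move=> EF; apply/funext => n; rewrite /pair_freq/= -mulrDl -big_split/=.
congr (_ / _); apply: eq_bigr => p _; rewrite !indicE in_setU.
set z := (_, _); have [zE|zE] := pselect (E z); last by rewrite (memNset zE) add0r.
rewrite (mem_set zE) memNset ?addr0// => zF.
by have : (E `&` F) z by []; rewrite EF.
Qed.

(** The indicator of a product set is a product of indicators, so the double sum factors. *)
Lemma pair_freqX A B : pair_freq (A `*` B) = freq f x A \* freq f x B.
Proof.
apply/funext => n; rewrite /pair_freq /freq/= mulf_div -expr2; congr (_ / _).
rewrite big_distrlr/= pair_big/=; apply: eq_bigr => p _.
by rewrite !indicE in_setX -natrM mulnb.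
Qed.

End pair_frequency.

Lemma correlation_sumE (R : realType) (X : pmetricType R) (f : X -> X) m x n eps :
  correlation_sum f m x n eps =
  pair_freq f x [set yz | bowen_dist f m yz.1 yz.2 <= eps] n.
Proof.
rewrite /correlation_sum /pair_freq; congr (_ / _).
rewrite -sum1_card natr_sum big_mkcond; apply: eq_bigr => p _.
rewrite indicE inE/=; set b := (_ <= eps).
by rewrite (_ : (_ \in _) = b); [case: b|apply/idP/idP; rewrite inE].
Qed.

(** * Equidistribution of pairs and convergence of correlation sums *)

Section pair_unique_ergodicity.
Context {R : realType} {X : pmetricType R} (f : X -> X).
Hypotheses (cX : compact [set: X]) (cf : continuous f).
Hypothesis uf : uniquely_ergodic f.
Context (mu : probability (borel X) R).
Hypothesis fmu : invariant_measure f mu.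

Local Notation mu2 := (mu \x mu)%E.

Lemma mu2X (A B : set (borel X)) : measurable A -> measurable B ->
  mu2 (A `*` B) = (mu A * mu B)%E.
Proof. exact: product_measure1E. Qed.

Lemma mu2_fin (E : set (borel X * borel X)) : measurable E -> mu2 E \is a fin_num.
Proof.
move=> mE; rewrite ge0_fin_numE//; apply: (@le_lt_trans _ _ (mu2 setT)).
  by apply: le_measure; rewrite ?inE.
by rewrite -setXTT mu2X// probability_setT mule1 ltry.
Qed.

Definition equidistributed (E : set (borel X * borel X)) :=
  measurable E /\ forall x, pair_freq f x E @ \oo --> fine (mu2 E).

Lemma equidistributed0 : equidistributed set0.
Proof.
split=> // x; rewrite measure0 (_ : pair_freq f x set0 = cst 0).
  exact: cvg_cst.
by apply/funext => n; rewrite pair_freq0.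
Qed.

Lemma equidistributedU E F : E `&` F = set0 ->
  equidistributed E -> equidistributed F -> equidistributed (E `|` F).
Proof.
move=> EF [mE cE] [mF cF]; split; first exact: measurableU.
move=> x; rewrite pair_freqU// measureU// fineD ?mu2_fin//.
by apply: cvgD.
Qed.

Lemma equidistributedX A B :
  squeezed mu A -> squeezed mu B -> equidistributed (A `*` B).
Proof.
move=> sA sB; have [mA _] := sA; have [mB _] := sB.
split; first exact: measurableX.
move=> x; rewrite pair_freqX mu2X// fineM ?fin_num_measure//.
by apply: cvgM; exact: cvg_freq.
Qed.

Lemma equidistributed_big (I : choiceType) (s : seq I)
    (E : I -> set (borel X * borel X)) :
  uniq s -> (forall i j, i != j -> E i `&` E j = set0) ->
  (forall i, equidistributed (E i)) ->
  equidistributed (\big[setU/set0]_(i <- s) E i).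
Proof.
move=> + tE eE; elim: s => [|i s ih].
  by rewrite big_nil => _; exact: equidistributed0.
move=> /= /andP[is_ us]; rewrite big_cons.
apply: equidistributedU => //; last exact: ih.
rewrite -bigcup_seq setI_bigcupr bigcup0// => j /= js; apply: tE.
by apply: contraNneq is_ => ->.
Qed.

(** With cells of diameter below $\delta/2$, each pair in a selected product is within $\delta/2$,
    in each coordinate, of a pair at Bowen distance at most [eps]; the two errors add up to at most
    $\delta$. *)
Lemma equidistributed_sandwich m (eps delta : R) : 0 < delta ->
  exists E, [/\ equidistributed E,
    [set yz | bowen_dist f m yz.1 yz.2 <= eps] `<=` E &
    E `<=` [set yz | bowen_dist f m yz.1 yz.2 <= eps + delta]].
Proof.
move=> delta0; have delta20 : 0 < delta / 2 by lra.
have [k [A [tA sA TA dA]]] := squeezed_cells mu cX (bowen_distxx f m)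
  (bowen_dist_sym f m) (bowen_dist_triangle f m)
  (fun y => @continuous_bowen_dist _ _ f m y cf) delta20.
pose meets (ij : nat * nat) := `[< exists y z, [/\ A ij.1 y, A ij.2 z &
  bowen_dist f m y z <= eps] >].
pose s := [seq ij <- [seq (i, j) | i <- iota 0 k, j <- iota 0 k] | meets ij].
exists (\big[setU/set0]_(ij <- s) (A ij.1 `*` A ij.2)); split.
- apply: equidistributed_big.
  + by rewrite filter_uniq// allpairs_uniq ?iota_uniq// => -[i j] [i' j'].
  + move=> [i j] [i' j'] ij; apply/seteqP.
    split=> // -[y z] /= [[Ay Az] [Ay' Az']].
    move/eqP: ij; apply; congr (_, _).
      by apply: (tA i i') => //; exists y.
    by apply: (tA j j') => //; exists z.
  + by move=> ij; exact: equidistributedX.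
- move=> [y z] /= yz; rewrite -bigcup_seq.
  have [i /= ik Ay] := TA y I; have [j /= jk Az] := TA z I.
  exists (i, j) => //=; rewrite mem_filter; apply/andP; split.
    by apply/asboolP; exists y, z.
  by apply/allpairsP; exists (i, j); rewrite !mem_iota !add0n.
- rewrite -bigcup_seq => -[y z] [[i j] /=].
  rewrite mem_filter => /andP[/asboolP[y' [z' /= [Ay' Az' yz']]] _] [Ay Az].
  have := dA _ _ _ Ay Ay'; have := dA _ _ _ Az' Az.
  have := bowen_dist_triangle f m y y' z; have := bowen_dist_triangle f m y' z' z.
  lra.
Qed.

(** The set is the intersection of the sandwiching sets for $\delta=1/(j+1)$, each measurable for
    the product sigma-algebra as a finite union of rectangles. *)
Lemma measurable_bowen_ball m (eps : R) :
  measurable [set yz : borel X * borel X | bowen_dist f m yz.1 yz.2 <= eps].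
Proof.
have j0 (j : nat) : 0 < j.+1%:R^-1 :> R by rewrite invr_gt0.
have /choice[E hE] := fun j => equidistributed_sandwich m eps (j0 j).
rewrite (_ : mkset _ = \bigcap_j E j).
  by apply: bigcapT_measurable => j; have [[]] := hE j.
apply/seteqP; split=> [yz yzE j _|yz Eyz /=]; first by have [_ + _] := hE j; exact.
apply/ler_addgt0Pr => e e0; have [j] := @ltr_add_invr R 0 e e0; rewrite add0r => je.
have [_ _ /(_ _ (Eyz j I)) /= h] := hE j.
by apply: (le_trans h); rewrite lerD2l ltW.
Qed.

Lemma le_correlation_integral m (E : set (borel X * borel X)) eps :
  measurable E ->
  E `<=` [set yz | bowen_dist f m yz.1 yz.2 <= eps] ->
  (mu2 E <= correlation_integral f m mu eps)%E.
Proof.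
move=> mE EB; apply: le_measure => //; rewrite inE//; exact: measurable_bowen_ball.
Qed.

(** Sandwiches at [eps] and at [eps - r / 2] give $F\subseteq\{d\le\varepsilon\}\subseteq E$, so the
    correlation sum lies between the pair frequencies of $F$ and $E$. Their limits lie between
    $c(\varepsilon-r/2)$ and $c(\varepsilon+r/2)$, both within $e/2$ of $c(\varepsilon)$;
    convergence of the frequencies costs the other $e/2$. *)
Lemma cvg_correlation_sum m x (eps : R) :
  {for eps, continuous (correlation_integral f m mu)} ->
  (correlation_sum f m x n eps)%:E @[n --> \oo] -->
    correlation_integral f m mu eps.
Proof.
move=> ceps.
have cfin e : correlation_integral f m mu e \is a fin_num.
  by apply: mu2_fin; exact: measurable_bowen_ball.
pose c e := fine (correlation_integral f m mu e).
have cE e : correlation_integral f m mu e = (c e)%:E by rewrite fineK.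
rewrite cE; apply: cvg_EFin; first exact: nearW.
(* Finiteness of the correlation integral carries its continuity at [eps] from the extended reals to
   the reals. *)
have {}ceps : c e @[e --> eps] --> c eps.
  by apply: fine_cvg; rewrite fineK.
apply/cvgrPdist_lt => e e0.
have e20 : 0 < e / 2 by lra.
move/cvgrPdist_lt: ceps => /(_ _ e20) /nbhs_ballP[r /= r0 cr].
have cabs u : `|eps - u| < r -> `|c eps - c u| < e / 2 by exact: cr.
have r20 : 0 < r / 2 by lra.
have [E [[mE cE'] DE ED]] := equidistributed_sandwich m eps r20.
have [F [[mF cF] DF FD]] := equidistributed_sandwich m (eps - r / 2) r20.
have cmu u (G : set (borel X * borel X)) : measurable G ->
    G `<=` [set yz | bowen_dist f m yz.1 yz.2 <= u] -> fine (mu2 G) <= c u.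
  move=> mG Gu; rewrite fine_le//; [exact: mu2_fin|exact: le_correlation_integral].
have hE := cmu _ _ mE ED.
have hF : c (eps - r / 2) <= fine (mu2 F).
  rewrite fine_le//; first exact: mu2_fin.
  by apply: le_measure => //; rewrite inE//; exact: measurable_bowen_ball.
have c1 : `|c eps - c (eps + r / 2)| < e / 2.
  by apply: cabs; rewrite opprD addrA subrr sub0r normrN gtr0_norm//; lra.
have c2 : `|c eps - c (eps - r / 2)| < e / 2.
  by apply: cabs; rewrite opprB addrC subrK gtr0_norm//; lra.
have /cvgrPdist_lt/(_ _ e20) nE := cE' x.
have /cvgrPdist_lt/(_ _ e20) nF := cF x.
near=> n.
have nEn : `|fine (mu2 E) - pair_freq f x E n| < e / 2 by near: n.
have nFn : `|fine (mu2 F) - pair_freq f x F n| < e / 2 by near: n.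
have CE : correlation_sum f m x n eps <= pair_freq f x E n.
  by rewrite correlation_sumE; exact: le_pair_freq.
have CF : pair_freq f x F n <= correlation_sum f m x n eps.
  by rewrite correlation_sumE; apply: le_pair_freq => yz /FD /=; rewrite subrK.
move: c1 c2 nEn nFn; rewrite !ltr_norml; lra.
Unshelve. all: by end_near. Qed.

End pair_unique_ergodicity.

Theorem proposition3 (R : realType) (X : pmetricType R) (f : X -> X)
    (cX : compact [set: X]) (cf : continuous f) (uf : uniquely_ergodic f)
    (mu : probability (borel X) R) (fmu : invariant_measure f mu)
    (m : nat) (m_gt0 : (0 < m)%N) (x : X) (eps : R) (eps_gt0 : 0 < eps)
    (ceps : {for eps, continuous (correlation_integral f m mu)}) :
  lower_correlation f m x eps = upper_correlation f m x eps /\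
  upper_correlation f m x eps = correlation_integral f m mu eps.
Proof.
(* The lower and upper limits of a convergent sequence both equal its limit. *)
have [lowE upE] := cvg_limn_einf_sup
  (cvg_correlation_sum cX cf uf fmu x ceps).
by rewrite /lower_correlation /upper_correlation lowE upE.
Qed.
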